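(* Let $X$ be a compact Hausdorff space and $K$ a compact subset of the Banach space $C(X)$. The following are equivalent: (i) $K$ is polynomially convex in $C(X)$; (ii) there exist a unital commutative Banach algebra $A$ and a continuous function $f:X\to A$ such that $f(X)$ generates $A$ and $K=\vec{\mathrm{sp}}(f)$.
   Context: $C(X)$ is the space of continuous complex functions on $X$ with the uniform norm. Polynomials of finite type on a Banach space $E$ are finite sums of functions $x\mapsto c\,\phi_1(x)\cdots\phi_n(x)$ ($n\ge0$, $c\in\mathbb{C}$, $\phi_i\in E^*$); their algebra is $\mathscr{P}(E)$. A compact $K\subset E$ is polynomially convex if $K=\{x\in E:|P(x)|\le\sup_{y\in K}|P(y)|\text{ for all }P\in\mathscr{P}(E)\}$. ''$f(X)$ generates $A$'' means $A$ is the smallest closed subalgebra of $A$ containing $f(X)$ and the unit. The joint spectrum $\vec{\mathrm{sp}}(f)$ is the set of all functions $\lambda:X\to\mathbb{C}$ such that the ideal of $A$ generated by $\{\lambda(x)\mathbf 1-f(x):x\in X\}$ is proper; equivalently $\vec{\mathrm{sp}}(f)=\{\phi\circ f:\phi\in\mathfrak{M}(A)\}$, where $\mathfrak{M}(A)$ is the character space of $A$. *)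

(* Defs.v *)
From HB Require Import structures.
From mathcomp Require Import all_boot all_order all_algebra.
From mathcomp Require Import complex.
From mathcomp Require Import all_classical all_reals all_analysis.
Set Implicit Arguments. Unset Strict Implicit. Unset Printing Implicit Defensive.
Import Order.TTheory GRing.Theory Num.Theory.
Import numFieldNormedType.Exports.
Local Open Scope classical_set_scope.
Local Open Scope ring_scope.

HB.instance Definition _ (R : rcfType) := GRing.ComAlgebra.copy R[i] (R[i])^o.
HB.instance Definition _ (R : rcfType) := NormedModule.copy R[i] (R[i])^o.

(* ---------- The Banach space E = C(X) and its dual E^* ----------
   Elements of C(X) are the continuous functions X -> C; the uniform norm of
   g is  ||g|| = sup_t |g t|  (0 if X is empty).  *)

(* phi : E -> C is an element of E^* : a continuous (= bounded) linear
   functional on C(X), i.e. linear on C(X) and |phi g| <= M ||g||, written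
   with the sup unfolded: |phi g| <= M b for every upper bound b >= 0 of |g|. *)
Definition dual_elt (R : realType) (X : topologicalType)
    (phi : (X -> R[i]) -> R[i]) : Prop :=
  (forall (a : R[i]) (g h : X -> R[i]), continuous g -> continuous h ->
     phi (fun t => a * g t + h t) = a * phi g + phi h) /\
  exists M : R[i], 0 <= M /\
    forall g : X -> R[i], continuous g ->
      forall b : R[i], 0 <= b -> (forall t, `|g t| <= b) -> `|phi g| <= M * b.

Definition ft_poly (R : realType) (X : topologicalType)
    (P : (X -> R[i]) -> R[i]) : Prop :=
  exists (n : nat) (c : 'I_n -> R[i]) (d : 'I_n -> nat)
         (phi : 'I_n -> nat -> (X -> R[i]) -> R[i]),
    (forall (i : 'I_n) (j : nat), (j < d i)%N -> dual_elt (phi i j)) /\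
    forall g : X -> R[i], continuous g ->
      P g = \sum_(i < n) c i * \prod_(j < d i) phi i j g.

(* Polynomial convexity of K in C(X):
   K = { x in C(X) : |P x| <= sup_{y in K} |P y| for all P in P(E) },
   the supremum being unfolded as "every upper bound M of |P| on K
   bounds |P x|" (for K empty this gives the empty hull, as with the
   usual sup conventions). *)
Definition poly_convex (R : realType) (X : topologicalType)
    (K : set (X -> R[i])) : Prop :=
  K = [set x | continuous x /\
         forall P, ft_poly P ->
           forall M : R[i], (forall y, K y -> `|P y| <= M) -> `|P x| <= M].

Definition comm_banach_algebra (R : realType) (A : completeNormedModType R[i])
    (mul : A -> A -> A) (one : A) : Prop :=
  [/\ associative mul, commutative mul, left_id one mul,
      left_distributive mul +%R &
      (forall (k : R[i]) (a b : A), mul (k *: a) b = k *: mul a b)] /\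
  (forall a b : A, `|mul a b| <= `|a| * `|b|).

Definition generates (R : realType) (A : completeNormedModType R[i])
    (mul : A -> A -> A) (one : A) (S0 : set A) : Prop :=
  forall S : set A, closed S -> S one ->
    (forall a b, S a -> S b -> S (a + b)) ->
    (forall a b, S a -> S b -> S (mul a b)) ->
    (forall (k : R[i]) a, S a -> S (k *: a)) ->
    S0 `<=` S -> S = setT.

(* Joint spectrum of f : X -> A: the functions lam : X -> C such that the
   ideal generated by { lam x * 1 - f x : x in X } is proper, i.e. 1 is not
   a finite combination  sum_k a_k (lam x_k 1 - f x_k). *)
Definition joint_spectrum (R : realType) (A : completeNormedModType R[i])
    (mul : A -> A -> A) (one : A) (X : Type) (f : X -> A) : set (X -> R[i]) :=
  [set lam | ~ exists s : seq (A * X),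
       one = \sum_(p <- s) mul p.1 (lam p.2 *: one - f p.2)].

(* Main.v *)
Require Import Defs.
From HB Require Import structures.
From mathcomp Require Import all_boot all_order all_algebra.
From mathcomp Require Import complex ring.
From mathcomp Require Import all_classical all_reals all_analysis.
Import Order.TTheory GRing.Theory Num.Theory.
Import numFieldNormedType.Exports.
Local Open Scope classical_set_scope.
Local Open Scope ring_scope.

(* Everything rests on the inequality |p(lam)| <= |p(f)| for lam in the joint
   spectrum of f and p a polynomial in finitely many evaluations: p(lam) - p(f)
   lies in a proper ideal, hence is not invertible, so the Neumann series
   forbids |p(f)| < |p(lam)|. No maximal ideals or characters are needed.
   (ii) => (i): if g is outside the spectrum, 1 = sum_k a_k (g x_k - f x_k);
   replacing the a_k by polynomials in f close to them produces a polynomial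
   that is small on the spectrum but has modulus 1 at g.
   (i) => (ii): take for A the uniform closure on K of the polynomials in
   evaluations and f x = (k |-> k x). The inequality bounds polynomials in
   evaluations at a point of the spectrum by their supremum over K; it extends
   to all polynomials of finite type because a bounded functional is, uniformly
   on functions h with |h x - h y| <= |f x - f y|, a limit of linear
   combinations of evaluations. *)

Set Implicit Arguments. Unset Strict Implicit. Unset Printing Implicit Defensive.

(** In [R[i]], [0 <= r] forces [r] to be real, so this is geometric decay of its real part. Dividing
    by [B + 1] covers [B = 0]. *)
Lemma expr_lt_complex (R : realType) (r B e : R[i]) :
  0 <= r -> r < 1 -> 0 <= B -> 0 < e -> exists n, r ^+ n * B < e.
Proof.
move=> r0 r1 B0 e0.
have -> : r = (complex.Re r)%:C%C by rewrite RRe_real ?ger0_real.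
have eB : 0 < e / (B + 1) by rewrite divr_gt0// ltr_wpDl.
have eE : e / (B + 1) = (complex.Re (e / (B + 1)))%:C%C.
  by rewrite RRe_real ?gtr0_real.
have : `|complex.Re r| < 1.
  have -> : r = (complex.Re r)%:C%C by rewrite RRe_real ?ger0_real.
  rewrite ger0_norm ?lecR; rewrite -?ltcR -?lecR ?RRe_real ?ger0_real//.
move/cvg_expr/cvgrPdist_lt => /(_ (complex.Re (e / (B + 1)))).
rewrite -ltcR -eE => /(_ eB) [n _ /(_ n)] /= /(_ (leqnn _)).
rewrite sub0r normrN -ltcR -eE => h; exists n.
have : `|complex.Re r ^+ n|%:C%C * (B + 1) < e.
  by rewrite -ltr_pdivlMr // ltr_wpDl.
apply: le_lt_trans.
have r0' : 0 <= complex.Re r by rewrite -lecR RRe_real ?ger0_real.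
rewrite ger0_norm ?exprn_ge0// rmorphXn /=.
by rewrite ler_wpM2l ?lerDl// exprn_ge0// lecR.
Qed.

(** * Polynomial expressions in evaluations *)

Inductive pexpr (C X : Type) : Type :=
  | PConst of C
  | PGen of X
  | PAdd of pexpr C X & pexpr C X
  | PMul of pexpr C X & pexpr C X.
Arguments PGen {C X}.
Arguments PConst {C X}.

Fixpoint pval (C : pzRingType) (X : Type) (h : X -> C) (p : pexpr C X) : C :=
  match p with
  | PConst c => c
  | PGen x => h x
  | PAdd p q => pval h p + pval h q
  | PMul p q => pval h p * pval h q
  end.

(** One syntax tree has both a scalar value at [lam] and a value at [f] in the algebra, so the two
    can be compared by induction on the tree. *)
Fixpoint aval (C : pzRingType) (A : lmodType C) (mul : A -> A -> A) (one : A)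
    (X : Type) (f : X -> A) (p : pexpr C X) : A :=
  match p with
  | PConst c => c *: one
  | PGen x => f x
  | PAdd p q => aval mul one f p + aval mul one f q
  | PMul p q => mul (aval mul one f p) (aval mul one f q)
  end.

(** Expansion into monomials brings an expression to the sum-of-products shape that [ft_poly]
    demands. *)
Lemma pval_monomials (C : comPzRingType) (X : Type) (p : pexpr C X) :
  exists s : seq (C * seq X), forall h : X -> C,
    pval h p = \sum_(m <- s) m.1 * \prod_(x <- m.2) h x.
Proof.
elim: p => [c|x|p [s hs] q [t ht]|p [s hs] q [t ht]] /=.
- by exists [:: (c, [::])] => h; rewrite big_seq1 big_nil mulr1.
- by exists [:: (1, [:: x])] => h; rewrite !big_seq1 mul1r.
- by exists (s ++ t) => h; rewrite big_cat hs ht.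
exists [seq (m.1 * n.1, m.2 ++ n.2) | m <- s, n <- t] => h.
rewrite hs ht big_allpairs_dep /= mulr_suml; apply: eq_bigr => m _.
rewrite mulr_sumr; apply: eq_bigr => n _.
by rewrite big_cat /= mulrACA.
Qed.

Lemma dual_elt_eval (R : realType) (X : topologicalType) (x : X) :
  dual_elt (fun g : X -> R[i] => g x).
Proof. by split=> //; exists 1; split=> // g _ b _ /(_ x); rewrite mul1r. Qed.

Lemma ft_poly_pval (R : realType) (X : topologicalType) (p : pexpr R[i] X) :
  ft_poly (fun h => pval h p).
Proof.
have [s hs] := pval_monomials p.
exists (size s), (fun i => (tnth (in_tuple s) i).1),
  (fun i => size (tnth (in_tuple s) i).2),
  (* The default 0 is never reached: [j] stays below the length of the monomial. *)
  (fun i j g => if onth (tnth (in_tuple s) i).2 j is Some x then g x else 0).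
split.
  move=> i j; rewrite -onthTE.
  case: onth => // x _; exact: dual_elt_eval.
move=> g _; rewrite hs (big_tnth _ _ s); apply: eq_bigr => i _; congr (_ * _).
elim: (tnth _ i).2 => [|x l ih]; first by rewrite big_nil big_ord0.
by rewrite big_cons big_ord_recl /= ih.
Qed.

(** * Neumann series, spectral ideals and density in a commutative Banach algebra *)

Section BanachAlgebra.
Variables (R : realType) (A : completeNormedModType R[i]).
Variables (mul : A -> A -> A) (one : A).
Hypothesis hA : comm_banach_algebra mul one.

Let mulA : associative mul. Proof. by case: hA => -[]. Qed.
Let mulC : commutative mul. Proof. by case: hA => -[]. Qed.
Let mul1 : left_id one mul. Proof. by case: hA => -[]. Qed.
Let mulDl : left_distributive mul +%R. Proof. by case: hA => -[]. Qed.
Let mulZl (k : R[i]) (a b : A) : mul (k *: a) b = k *: mul a b.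
Proof. by case: hA => -[]. Qed.
Let norm_mul (a b : A) : `|mul a b| <= `|a| * `|b|.
Proof. by case: hA. Qed.
Let mulDr (a b c : A) : mul a (b + c) = mul a b + mul a c.
Proof. by rewrite mulC mulDl !(mulC a). Qed.
Let mulZr (k : R[i]) (a b : A) : mul a (k *: b) = k *: mul a b.
Proof. by rewrite mulC mulZl mulC. Qed.
Let mulNr (a b : A) : mul a (- b) = - mul a b.
Proof. by rewrite -scaleN1r mulZr scaleN1r. Qed.
Let mulBr (a b c : A) : mul a (b - c) = mul a b - mul a c.
Proof. by rewrite mulDr mulNr. Qed.
Let mulBl (a b c : A) : mul (a - b) c = mul a c - mul b c.
Proof. by rewrite mulC mulBr !(mulC c). Qed.
Let mul_sumr (a : A) (I : Type) (s : seq I) (F : I -> A) :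
  mul a (\sum_(i <- s) F i) = \sum_(i <- s) mul a (F i).
Proof.
elim: s => [|i s ih]; last by rewrite !big_cons mulDr ih.
by rewrite !big_nil -{1}(scale0r (0 : A)) mulZr scale0r.
Qed.

Lemma one_sub_invertible (a : A) : `|a| < 1 -> exists b, mul b (one - a) = one.
Proof.
move=> a1.
(* Partial sums of the Neumann series, in Horner form: [s n] is the sum of the powers of [a] of
   exponent below [n]. *)
pose s n := iter n (fun b => one + mul a b) 0.
have a1' : 0 < 1 - `|a| by rewrite subr_gt0.
(* [B] solves [B = |one| + |a| B], so the recursion for [s] preserves the bound [B]. *)
pose B := `|one| / (1 - `|a|).
have B0 : 0 <= B by rewrite divr_ge0// ltW.
have sB n : `|s n| <= B.
  elim: n => [|n ih]; first by rewrite normr0.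
  rewrite /= (le_trans (ler_normD _ _))//.
  have -> : B = `|one| + `|a| * B by rewrite /B; field; rewrite gt_eqF.
  by rewrite lerD2l (le_trans (norm_mul _ _))// ler_wpM2l.
have sD n k : `|s (n + k)%N - s n| <= `|a| ^+ n * B.
  elim: n => [|n ih]; first by rewrite subr0 mul1r.
  rewrite addSn /= opprD addrACA subrr add0r -mulBr (le_trans (norm_mul _ _))//.
  by rewrite exprS -mulrA ler_wpM2l.
have /cauchy_cvg/cvg_ex[l sl] : cauchy (s @ \oo).
  apply: cauchy_exP => e e0.
  have [n ne] := expr_lt_complex (normr_ge0 a) a1 B0 e0.
  exists (s n); exists n => // m /= nm.
  rewrite -ball_normE /ball_ /= distrC -(subnKC nm).
  exact: le_lt_trans (sD _ _) ne.
exists l.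
apply/eqP; rewrite -subr_eq0 -normr_le0.
apply/ler_addgt0Pr => e e0; rewrite add0r.
have e2 : 0 < e / (1 + `|a|) by rewrite divr_gt0// ltr_wpDr.
have /cvgrPdist_le/(_ _ e2)[n _ hn] := sl.
(* The recursion [s n.+1 = one + mul a (s n)] expresses the defect through two distances to the
   limit. *)
have -> : mul l (one - a) - one = (l - s n.+1) - mul a (l - s n).
  rewrite !mulBr (mulC l one) mul1 (mulC l a) /=.
  by rewrite opprD opprB !addrA subrK addrAC.
rewrite (le_trans (ler_normB _ _))//.
have -> : e = e / (1 + `|a|) + `|a| * (e / (1 + `|a|)).
  by field; rewrite gt_eqF// ltr_wpDr.
apply: lerD; first exact: (hn n.+1 (leqnSn n)).
rewrite (le_trans (norm_mul _ _))// ler_wpM2l//; exact: (hn n (leqnn n)).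
Qed.

Variables (X : Type) (f : X -> A).
Local Notation "p ^A" := (aval mul one f p) (at level 2, format "p ^A").

(** By definition, [lam] is in the joint spectrum exactly when this ideal does not contain [one]. *)
Definition spectral_ideal (lam : X -> R[i]) : set A :=
  [set a | exists s : seq (A * X),
       a = \sum_(p <- s) mul p.1 (lam p.2 *: one - f p.2)].

Lemma spectral_idealD (lam : X -> R[i]) (a b : A) :
  spectral_ideal lam a -> spectral_ideal lam b -> spectral_ideal lam (a + b).
Proof. by move=> [s ->] [t ->]; exists (s ++ t); rewrite big_cat. Qed.

Lemma spectral_idealM (lam : X -> R[i]) (a b : A) :
  spectral_ideal lam b -> spectral_ideal lam (mul a b).
Proof.
move=> [s ->]; exists [seq (mul a p.1, p.2) | p <- s].
by rewrite big_map mul_sumr; apply: eq_bigr => p _; rewrite /= mulA.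
Qed.

(** Modulo the ideal each [f x] equals the scalar [lam x], hence so do the polynomials in them. *)
Lemma spectral_ideal_aval (lam : X -> R[i]) (p : pexpr R[i] X) :
  spectral_ideal lam (pval lam p *: one - p^A).
Proof.
elim: p => [c|x|p ihp q ihq|p ihp q ihq] /=.
- by rewrite subrr; exists [::]; rewrite big_nil.
- by exists [:: (one, x)]; rewrite big_seq1 mul1.
- by rewrite scalerDl opprD addrACA; exact: spectral_idealD.
have -> : (pval lam p * pval lam q) *: one - mul p^A q^A =
  mul (pval lam p *: one) (pval lam q *: one - q^A) +
  mul q^A (pval lam p *: one - p^A).
  rewrite !mulBr !mulZl !mul1 !mulZr (mulC q^A one) mul1 (mulC q^A).
  by rewrite addrA subrK scalerA.
by apply: spectral_idealD; apply: spectral_idealM.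
Qed.

Lemma joint_spectrum_pval_le (lam : X -> R[i]) (p : pexpr R[i] X) :
  joint_spectrum mul one f lam -> `|pval lam p| <= `|p^A|.
Proof.
move=> spl; rewrite real_leNgt ?normr_real//; apply/negP => lt_p; apply: spl.
have p0 : pval lam p != 0 by rewrite -normr_gt0 (le_lt_trans _ lt_p).
have : `|(pval lam p)^-1 *: p^A| < 1.
  by rewrite normrZ normfV ltr_pdivrMl ?normr_gt0// mulr1.
case/(one_sub_invertible) => b hb.
change (spectral_ideal lam one); rewrite -[X in spectral_ideal _ X]hb.
(* The element just inverted is a multiple of [p(lam) - p(f)], so it lies in the ideal and brings
   [one] with it. *)
have -> : one - (pval lam p)^-1 *: p^A =
    mul ((pval lam p)^-1 *: one) (pval lam p *: one - p^A).
  by rewrite mulZl mul1 scalerBr scalerA mulVf// scale1r.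
by do 2![apply: spectral_idealM]; exact: spectral_ideal_aval.
Qed.

Lemma joint_spectrum_dist_le (lam : X -> R[i]) (x y : X) :
  joint_spectrum mul one f lam -> `|lam x - lam y| <= `|f x - f y|.
Proof.
move=> /(joint_spectrum_pval_le (PAdd (PGen x) (PMul (PConst (- 1)) (PGen y)))).
by rewrite /= mulN1r mulZl mul1 scaleN1r.
Qed.

(** The elements approximable by polynomials in [f] form a closed unital subalgebra containing the
    range of [f], hence all of [A]. *)
Lemma generates_dense (a : A) (e : R[i]) :
  generates mul one (range f) -> 0 < e -> exists p, `|a - p^A| <= e.
Proof.
move=> gen e0.
pose S := [set a : A | forall e : R[i], 0 < e -> exists p, `|a - p^A| <= e].
suff ST : S = setT by have : S a; [rewrite ST|exact].
apply: gen.
- move=> b Sb d d0.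
  have d2 : 0 < d / 2 by rewrite divr_gt0.
  have [c [/(_ _ d2)[p pc] cb]] := Sb _ (nbhsx_ballx b _ d2).
  exists p; rewrite -(subrK c b) -addrA (le_trans (ler_normD _ _))//.
  rewrite (splitr d) lerD//; move: cb.
  by rewrite -ball_normE /ball_ /= => /ltW.
- by move=> d d0; exists (PConst 1); rewrite /= scale1r subrr normr0 ltW.
- move=> b c Sb Sc d d0; have d2 : 0 < d / 2 by rewrite divr_gt0.
  have [p hp] := Sb _ d2; have [q hq] := Sc _ d2; exists (PAdd p q).
  by rewrite /= opprD addrACA (le_trans (ler_normD _ _))// (splitr d) lerD.
- move=> b c Sb Sc d d0; have d2 : 0 < d / 2 by rewrite divr_gt0.
  have [p hp] := Sb (d / 2 / (1 + `|c|)) (divr_gt0 d2 (ltr_pwDl ltr01 (normr_ge0 _))).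
  (* [q] comes after [p] because its tolerance depends on the norm of [p^A]; adding 1 keeps the
     denominator positive. *)
  have [q hq] := Sc (d / 2 / (1 + `|p^A|)) (divr_gt0 d2 (ltr_pwDl ltr01 (normr_ge0 _))).
  exists (PMul p q) => /=.
  have -> : mul b c - mul p^A q^A = mul (b - p^A) c + mul p^A (c - q^A).
    by rewrite mulBl mulBr addrA subrK.
  rewrite (le_trans (ler_normD _ _))// (splitr d) lerD//;
    rewrite (le_trans (norm_mul _ _))//.
    rewrite (le_trans (ler_wpM2r _ hp))// mulrAC ler_pdivrMr ?ltr_pwDl//.
    by rewrite ler_wpM2l ?(ltW d2)// lerDr.
  rewrite (le_trans (ler_wpM2l _ hq))// mulrC mulrAC ler_pdivrMr ?ltr_pwDl//.
  by rewrite ler_wpM2l ?(ltW d2)// lerDr.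
- move=> k b Sb d d0.
  have [p hp] := Sb (d / (1 + `|k|)) (divr_gt0 d0 (ltr_pwDl ltr01 (normr_ge0 _))).
  exists (PMul (PConst k) p); rewrite /= mulZl mul1 -scalerBr normrZ.
  rewrite (le_trans (ler_wpM2l _ hp))// mulrC mulrAC ler_pdivrMr ?ltr_pwDl//.
  by rewrite ler_wpM2l ?(ltW d0)// lerDr.
- by move=> _ [x _ <-] d d0; exists (PGen x); rewrite /= subrr normr0 ltW.
Qed.

(** Only the coefficients are approximated. Each factor [g x *: one - f x] is already the value of a
    polynomial vanishing at [g], so [pval g p = 0] holds exactly. *)
Lemma aval_combination (s : seq (A * X)) (g : X -> R[i]) (e : R[i]) :
  generates mul one (range f) -> 0 < e -> exists p : pexpr R[i] X,
    pval g p = 0 /\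
    `|\sum_(m <- s) mul m.1 (g m.2 *: one - f m.2) - p^A| <= e.
Proof.
move=> gen; elim: s e => [|m s ih] e e0.
  exists (PConst 0); split => //=.
  by rewrite big_nil scale0r subrr normr0 ltW.
have e2 : 0 < e / 2 by rewrite divr_gt0.
have [p [p0 hp]] := ih _ e2.
set v := g m.2 *: one - f m.2.
have [q hq] := generates_dense m.1 gen
  (divr_gt0 e2 (ltr_pwDl ltr01 (normr_ge0 v))).
exists (PAdd (PMul q (PAdd (PConst (g m.2)) (PMul (PConst (- 1)) (PGen m.2)))) p).
split=> /=; first by rewrite p0 mulN1r subrr mulr0 addr0.
rewrite big_cons -/v mulZl mul1 scaleN1r -/v opprD addrACA.
rewrite (le_trans (ler_normD _ _))// (splitr e) lerD// -mulBl.
rewrite (le_trans (norm_mul _ _))//.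
rewrite (le_trans (ler_wpM2r _ hq))// mulrAC ler_pdivrMr ?ltr_pwDl//.
by rewrite ler_wpM2l ?(ltW e2)// lerDr.
Qed.

End BanachAlgebra.

(** * Polynomial convexity of joint spectra *)

Lemma continuous_of_dist_le (R : realType) (X : topologicalType)
    (V : normedModType R[i]) (f : X -> V) (h : X -> R[i]) :
  continuous f -> (forall x y, `|h x - h y| <= `|f x - f y|) -> continuous h.
Proof.
move=> cf hf x; apply/cvgrPdist_le => e e0.
have /cvgrPdist_le/(_ _ e0) := cf x.
by apply: filterS => y; exact: le_trans.
Qed.

Lemma joint_spectrum_continuous (R : realType) (A : completeNormedModType R[i])
    (mul : A -> A -> A) (one : A) (X : topologicalType) (f : X -> A)
    (lam : X -> R[i]) :
  comm_banach_algebra mul one -> continuous f ->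
  joint_spectrum mul one f lam -> continuous lam.
Proof.
move=> hA cf spl; apply: (continuous_of_dist_le cf) => x y.
exact: joint_spectrum_dist_le spl.
Qed.

Lemma joint_spectrum_poly_convex (R : realType) (A : completeNormedModType R[i])
    (mul : A -> A -> A) (one : A) (X : topologicalType) (f : X -> A) :
  comm_banach_algebra mul one -> continuous f ->
  generates mul one (range f) -> poly_convex (joint_spectrum mul one f).
Proof.
move=> hA cf gen; apply/seteqP; split=> [lam spl|g [cg hg] [s os]].
  split; first exact: joint_spectrum_continuous spl.
  by move=> P _ M; exact.
have h2 : 0 < 2^-1 :> R[i] by rewrite invr_gt0.
have [p [p0 hp]] := aval_combination hA s g gen h2.
(* [q = 1 - p] is 1 at [g], while [q(f)] has norm at most 1/2 because [one] is the combination that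
   [p(f)] approximates. *)
pose q := PAdd (PConst 1) (PMul (PConst (-1)) p).
have : `|pval g q| <= 2^-1.
  apply: (hg (fun h => pval h q) (ft_poly_pval q) 2^-1) => y.
  move/(joint_spectrum_pval_le hA q)/le_trans; apply.
  rewrite /=; case: (hA) => -[_ _ m1 _ ->] _.
  by rewrite m1 scale1r scaleN1r {1}os.
rewrite /= p0 mulr0 addr0 normr1 => /le_lt_trans/(_ (_ : 2^-1 < 1)).
by rewrite ltxx invf_lt1 ?ltr1n// => /(_ isT).
Qed.

(** * Completeness of the complex numbers *)

Lemma normc_le_Re_Im (R : rcfType) (z : R[i]) :
  `|z| <= (`|complex.Re z| + `|complex.Im z|)%:C%C.
Proof.
rewrite {1}[z]complexE (le_trans (ler_normD _ _))// rmorphD /= lerD//.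
  by rewrite normc_def /= expr0n addr0 sqrtr_sqr.
by rewrite normrM !normc_def /= !expr0n !expr1n add0r addr0 sqrtr1 mul1r sqrtr_sqr.
Qed.

(** Real and imaginary parts are additive and bounded by the modulus, so both map [F] to a Cauchy
    filter of reals; the two limits are recombined. *)
Lemma complex_cauchy_cvg (R : realType) (F : set_system R[i]) :
  ProperFilter F -> cauchy F -> cvg F.
Proof.
move=> FF /cauchyP Fc.
have cvg_part (part : R[i] -> R) :
    (forall x y, part (x - y) = part x - part y) ->
    (forall x, `|part x|%:C%C <= `|x|) -> cvg (part @ F).
  move=> partB part_le; apply: cauchy_cvg; apply: cauchy_exP => e e0.
  have [|z Fz] := Fc e%:C%C; first by rewrite ltcR.
  exists (part z); change (F (part @^-1` ball (part z) e)).
  apply: filterS Fz => w.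
  rewrite -!ball_normE /ball_ /= -ltcR -partB; exact: le_lt_trans.
have /cvg_ex[a Fa] := cvg_part (@complex.Re R) (fun x y => raddfB _ x y) (@normc_ge_Re R).
have Im_le (x : R[i]) : `|complex.Im x|%:C%C <= `|x|.
  rewrite normc_def lecR -sqrtr_sqr ler_wsqrtr// lerDr sqr_ge0//.
have /cvg_ex[b Fb] := cvg_part (@complex.Im R) (fun x y => raddfB _ x y) Im_le.
apply/cvg_ex; exists (a +i* b)%C; apply/fcvg_ballP => e e0.
have eE : e = (complex.Re e)%:C%C by rewrite RRe_real// gtr0_real.
have e2 : 0 < complex.Re e / 2 by rewrite divr_gt0// -ltcR -eE.
move/cvgrPdist_lt/(_ _ e2): Fa; move/cvgrPdist_lt/(_ _ e2): Fb.
apply: filterS2 => z hb ha; rewrite -ball_normE /ball_ /=.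
rewrite (le_lt_trans (normc_le_Re_Im _))// eE ltcR (splitr (complex.Re e)).
by case: z ha hb => z1 z2 /= ha hb; rewrite ltrD.
Qed.

(** * The uniform closure of the polynomials in evaluations *)

(** Used for two index sets: [K] itself, which yields the algebra, and a larger set that also
    contains a given point of the spectrum. *)
Record bounded_family (R : realType) (S X : Type) := BoundedFamily {
  family_eval :> S -> X -> R[i];
  family_bounded : forall x, exists M : R[i], forall s, `|family_eval s x| <= M }.

Section UniformApproximation.
Variables (R : realType) (S X : Type) (h : bounded_family R S X).

Definition uapprox : set (S -> R[i]) :=
  [set a | forall e : R[i], 0 < e ->
     exists p, forall s, `|a s - pval (h s) p| <= e].

Lemma pval_bounded (p : pexpr R[i] X) :
  exists2 M : R[i], 0 <= M & forall s, `|pval (h s) p| <= M.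
Proof.
elim: p => [c|x|p [M M0 hM] q [N N0 hN]|p [M M0 hM] q [N N0 hN]] /=.
- by exists `|c|.
(* The bound from the family is known to be nonnegative only when some [s] exists; otherwise 0
   serves. *)
- have [M hM] := family_bounded h x; have [[s]|noS] := pselect (inhabited S).
    by exists M => //; exact: le_trans (hM s).
  by exists 0 => // s; case: noS.
- exists (M + N) => [|s]; first exact: addr_ge0.
  by rewrite (le_trans (ler_normD _ _))// lerD.
- exists (M * N) => [|s]; first exact: mulr_ge0.
  by rewrite normrM ler_pM.
Qed.

Lemma uapprox_bounded (a : S -> R[i]) :
  uapprox a -> exists2 M : R[i], 0 <= M & forall s, `|a s| <= M.
Proof.
move=> /(_ 1 ltr01)[p hp]; have [M M0 hM] := pval_bounded p.
exists (1 + M) => [|s]; first exact: addr_ge0.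
by rewrite -[a s](subrK (pval (h s) p)) (le_trans (ler_normD _ _))// lerD.
Qed.

Lemma uapprox_pval (p : pexpr R[i] X) : uapprox (fun s => pval (h s) p).
Proof. by move=> e e0; exists p => s; rewrite subrr normr0 ltW. Qed.

Lemma uapproxD (a b : S -> R[i]) :
  uapprox a -> uapprox b -> uapprox (fun s => a s + b s).
Proof.
move=> ha hb e e0; have e2 : 0 < e / 2 by rewrite divr_gt0.
have [p hp] := ha _ e2; have [q hq] := hb _ e2.
exists (PAdd p q) => s /=.
by rewrite opprD addrACA (le_trans (ler_normD _ _))// (splitr e) lerD.
Qed.

Lemma uapproxM (a b : S -> R[i]) :
  uapprox a -> uapprox b -> uapprox (fun s => a s * b s).
Proof.
move=> ha hb e e0; have e2 : 0 < e / 2 by rewrite divr_gt0.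
have [N N0 hN] := uapprox_bounded hb.
have [p hp] := ha _ (divr_gt0 e2 (ltr_pwDl ltr01 N0)).
have [M M0 hM] := pval_bounded p.
have [q hq] := hb _ (divr_gt0 e2 (ltr_pwDl ltr01 M0)).
exists (PMul p q) => s /=.
have -> : a s * b s - pval (h s) p * pval (h s) q =
  (a s - pval (h s) p) * b s + pval (h s) p * (b s - pval (h s) q) by ring.
rewrite (le_trans (ler_normD _ _))// (splitr e) lerD// normrM.
  apply: (le_trans (ler_pM _ _ (hp s) (hN s))) => //.
  by rewrite mulrAC ler_pdivrMr ?ltr_pwDl// ler_wpM2l ?(ltW e2)// lerDr.
apply: (le_trans (ler_pM _ _ (hM s) (hq s))) => //.
by rewrite mulrC mulrAC ler_pdivrMr ?ltr_pwDl// ler_wpM2l ?(ltW e2)// lerDr.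
Qed.

Lemma uapprox_limit (a : S -> R[i]) :
  (forall e : R[i], 0 < e ->
     exists2 b, uapprox b & forall s, `|a s - b s| <= e) -> uapprox a.
Proof.
move=> ha e e0; have e2 : 0 < e / 2 by rewrite divr_gt0.
have [b ub ab] := ha _ e2; have [p bp] := ub _ e2; exists p => s.
rewrite -(subrK (b s) (a s)) -addrA (le_trans (ler_normD _ _))//.
by rewrite (splitr e) lerD.
Qed.

Definition uapprox_pred : {pred S -> R[i]} := fun a => `[< uapprox a >].

Lemma uapprox_submod_closed : submod_closed uapprox_pred.
Proof.
split=> [|k a b /asboolP ha /asboolP hb]; apply/asboolP.
  exact: (uapprox_pval (PConst 0)).
exact: (uapproxD (uapproxM (uapprox_pval (PConst k)) ha) hb).
Qed.

HB.instance Definition _ :=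
  GRing.isSubmodClosed.Build R[i] (S -> R[i]) uapprox_pred uapprox_submod_closed.

Record polyalg := PolyAlg { polyalg_fun :> S -> R[i];
                            _ : polyalg_fun \in uapprox_pred }.

HB.instance Definition _ := [isSub for polyalg_fun].
HB.instance Definition _ := [Choice of polyalg by <:].
HB.instance Definition _ := [SubChoice_isSubZmodule of polyalg by <:].
HB.instance Definition _ := [SubZmodule_isSubLmodule of polyalg by <:].

Lemma polyalgP (a : polyalg) : uapprox a.
Proof. by case: a => a /= /asboolP. Qed.

Lemma polyalg_ext (a b : polyalg) : (forall s, a s = b s) -> a = b.
Proof. by move=> ab; apply: val_inj; apply: funext. Qed.

(** The sup norm over [S]. The supremum is taken in [R] and embedded back into [R[i]]; for empty [S]
    it is 0. *)
Definition polyalg_norm (a : polyalg) : R[i] :=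
  (sup (range (fun s => complex.Re `|a s|)))%:C%C.

Let ReE (z : R[i]) : (complex.Re `|z|)%:C%C = `|z|.
Proof. by rewrite RRe_real// normr_real. Qed.

Lemma polyalg_norm_ge (a : polyalg) (s : S) : `|a s| <= polyalg_norm a.
Proof.
have [M M0 hM] := uapprox_bounded (polyalgP a).
rewrite -ReE lecR; apply: ub_le_sup; last by exists s.
exists (complex.Re M) => _ [t _ <-].
by rewrite -lecR ReE RRe_real// ger0_real.
Qed.

Lemma polyalg_norm_le (a : polyalg) (b : R[i]) :
  0 <= b -> (forall s, `|a s| <= b) -> polyalg_norm a <= b.
Proof.
move=> b0 ab; rewrite /polyalg_norm -(RRe_real (ger0_real b0)) lecR.
have [[s]|noS] := pselect (inhabited S).
  apply: ge_sup; first by exists (complex.Re `|a s|), s.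
  by move=> _ [t _ <-]; rewrite -lecR ReE RRe_real// ger0_real.
have -> : range (fun s => complex.Re `|a s|) = set0.
  by apply/seteqP; split=> // t [s]; case: noS.
by rewrite sup0 -lecR RRe_real// ger0_real.
Qed.

Lemma polyalg_norm_ge0 (a : polyalg) : 0 <= polyalg_norm a.
Proof.
have [[s]|noS] := pselect (inhabited S).
  exact: le_trans (polyalg_norm_ge a s).
rewrite /polyalg_norm; have -> : range (fun s => complex.Re `|a s|) = set0.
  by apply/seteqP; split=> // t [s]; case: noS.
by rewrite sup0.
Qed.

Lemma polyalg_normD (a b : polyalg) :
  polyalg_norm (a + b) <= polyalg_norm a + polyalg_norm b.
Proof.
apply: polyalg_norm_le => [|s]; first by rewrite addr_ge0// polyalg_norm_ge0.
by rewrite (le_trans (ler_normD _ _))// lerD// polyalg_norm_ge.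
Qed.

Lemma polyalg_normZ (k : R[i]) (a : polyalg) :
  polyalg_norm (k *: a) = `|k| * polyalg_norm a.
Proof.
have le_normZ l b : polyalg_norm (l *: b) <= `|l| * polyalg_norm b.
  apply: polyalg_norm_le => [|s]; first by rewrite mulr_ge0// polyalg_norm_ge0.
  by rewrite normrM ler_wpM2l// polyalg_norm_ge.
apply/eqP; rewrite eq_le le_normZ /=.
have [->|k0] := eqVneq k 0; first by rewrite normr0 mul0r polyalg_norm_ge0.
(* The reverse inequality is the one already shown, applied to the inverse scalar. *)
have := le_normZ k^-1 (k *: a).
by rewrite scalerA mulVf// scale1r normfV ler_pdivlMl ?normr_gt0.
Qed.

Lemma polyalg_norm0_eq0 (a : polyalg) : polyalg_norm a = 0 -> a = 0.
Proof.
move=> a0; apply: polyalg_ext => s; apply/eqP.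
by rewrite -normr_le0 -a0 polyalg_norm_ge.
Qed.

HB.instance Definition _ := Lmodule_isNormed.Build R[i] polyalg
  polyalg_normD polyalg_normZ polyalg_norm0_eq0.

(** Evaluation at [s] does not increase the norm, so pointwise limits exist. The Cauchy property
    makes the convergence uniform, and uniform limits stay in [uapprox]. *)
Lemma polyalg_cauchy_cvg (F : set_system polyalg) :
  ProperFilter F -> cauchy F -> cvg F.
Proof.
move=> FF /cauchyP Fc.
have cvg_at s : cvg ((fun a : polyalg => a s) @ F).
  apply: complex_cauchy_cvg; apply: cauchy_exP => e e0.
  have [a Fa] := Fc e e0; exists (a s).
  change (F ((fun a : polyalg => a s) @^-1` ball (a s) e)).
  apply: filterS Fa => b; rewrite -!ball_normE /ball_ /=.
  exact/le_lt_trans/(polyalg_norm_ge (a - b)).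
pose g s := lim ((fun a : polyalg => a s) @ F).
have near_g e : 0 < e -> exists2 a : polyalg, F (ball a e) & forall s, `|g s - a s| <= e.
  move=> e0; have [a Fa] := Fc e e0; exists a => // s.
  have /cvgrPdist_le gs := cvg_at s.
  (* With slack [d], [g s] can be compared with [b s] for some [b] within [e] of [a]. *)
  apply/ler_addgt0Pr => d d0.
  near F => b.
  rewrite -(subrK (b s) (g s)) -addrA addrC (le_trans (ler_normD _ _))// lerD//.
    have : ball a e b by near: b.
    rewrite -ball_normE /ball_ /= distrC => /ltW.
    exact: le_trans (polyalg_norm_ge (b - a) s).
  by near: b; exact: gs.
have ug : g \in uapprox_pred.
  apply/asboolP; apply: uapprox_limit => e /near_g[a _ ga].
  by exists a => //; exact: polyalgP.
apply/cvg_ex; exists (PolyAlg ug); apply/cvgrPdist_le => e e0.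
have e2 : 0 < e / 2 by rewrite divr_gt0.
have [a Fa ga] := near_g _ e2; apply: filterS Fa => b.
rewrite -ball_normE /ball_ /= => /ltW ab.
rewrite -(subrK a (PolyAlg ug)) -addrA (le_trans (ler_normD _ _))//.
rewrite (splitr e) lerD//; apply: polyalg_norm_le => //; exact: ltW.
Unshelve. all: by end_near. Qed.

HB.instance Definition _ := Uniform_isComplete.Build polyalg polyalg_cauchy_cvg.

End UniformApproximation.

Set Implicit Arguments. Unset Strict Implicit. Unset Printing Implicit Defensive.

(** * Equicontinuity and boundedness of compact families *)

Section CompactFamily.
Variables (R : realType) (X : topologicalType) (K : set (X -> R[i])).
Hypothesis K_continuous : forall k, K k -> continuous k.
Hypothesis K_compact : @compact {uniform X -> R[i]} K.

Lemma near_uniform (k : {uniform X -> R[i]}) (e : R[i]) : 0 < e ->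
  \forall k' \near k, forall x, `|k x - k' x| < e.
Proof.
move=> e0; apply/uniform_nbhs.
exists [set xy | ball xy.1 e xy.2]; split.
  by rewrite -entourage_ballE; exists e.
by move=> k' /= kk' x; have := kk' x I; rewrite -ball_normE.
Qed.

(** The elementary half of Arzela-Ascoli: a three-term estimate near each [k], and compactness in
    near-covering form makes the neighbourhood of [x] independent of [k]. *)
Lemma compact_equicontinuous_at (x : X) (e : R[i]) : 0 < e ->
  \forall y \near x, forall k, K k -> `|k x - k y| <= e.
Proof.
move=> e0; have e3 : 0 < e / 3 by rewrite divr_gt0.
move/compact_near_coveringP: K_compact.
apply => k Kk.
have ck : \forall y \near x, `|k x - k y| < e / 3.
  by have /cvgrPdist_lt/(_ _ e3) := @K_continuous _ Kk x.
exists ([set k' | forall y, `|k y - k' y| < e / 3], [set y | `|k x - k y| < e / 3]).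
  by split=> //; exact: near_uniform.
move=> [k' y] /= [kk' kxy].
have -> : k' x - k' y = - (k x - k' x) + ((k x - k y) + (k y - k' y)) by ring.
have -> : e = e / 3 + (e / 3 + e / 3) by field.
rewrite (le_trans (ler_normD _ _))// normrN lerD ?(ltW (kk' x))//.
by rewrite (le_trans (ler_normD _ _))// lerD ?ltW.
Qed.

(** Near each [k] the bound [|k x| + 1] works; near-covering compactness along [\oo] gives one
    natural number for all of [K]. *)
Lemma compact_bounded_at (x : X) :
  exists M : R[i], forall k, K k -> `|k x| <= M.
Proof.
move/compact_near_coveringP: K_compact.
move=> /(_ nat \oo (fun n k => `|k x| <= n%:R :> R[i]) _) [|N _ /(_ N)].
  move=> k Kk; set r := complex.Re (`|k x| + 1).
  have rE : r%:C%C = `|k x| + 1 by rewrite RRe_real// rpredD// normr_real.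
  exists ([set k' | forall y, `|k y - k' y| < 1],
          [set n | (Num.bound r <= n)%N]).
    by split; [exact: near_uniform|exists (Num.bound r)].
  move=> [k' n] /= [kk' rn].
  have -> : k' x = k x - (k x - k' x) by ring.
  rewrite (le_trans (ler_normB _ _))//.
  apply: (@le_trans _ _ (`|k x| + 1)); first by rewrite lerD2l ltW.
  rewrite -rE -(rmorph_nat (real_complex R)) lecR.
  apply: le_trans (ltW (archi_boundP _)) _; last by rewrite ler_nat.
  by rewrite -lecR rE addr_ge0.
by move=> /(_ (leqnn N)) h; exists N%:R => k /h.
Qed.

End CompactFamily.

(** * Approximation of functionals by combinations of evaluations *)

Lemma sum_continuous (R : realType) (X : topologicalType) (I : Type)
    (s : seq I) (F : I -> X -> R[i]) :
  (forall i, continuous (F i)) -> continuous (fun x => \sum_(i <- s) F i x).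
Proof.
move=> cF; elim: s => [|i s ih].
  rewrite (_ : (fun x => _) = cst 0); first by move=> x; exact: cvg_cst.
  by apply/funext => x; rewrite big_nil.
rewrite (_ : (fun x => _) = F i \+ (fun x => \sum_(j <- s) F j x)).
  by move=> x; apply: cvgD; [exact: cF|exact: ih].
by apply/funext => x; rewrite big_cons.
Qed.

(* [v y] is the normalized [u y], with [u y x] twice the positive part of
   [d - |f x - f y|] and [y] ranging over a [d]-net for [|f x - f y|]. *)
Lemma partition_of_unity (R : realType) (X : topologicalType)
    (V : normedModType R[i]) (f : X -> V) (d : R[i]) :
  compact [set: X] -> continuous f -> 0 < d ->
  exists (s : seq X) (v : X -> X -> R[i]),
    [/\ forall y, continuous (v y), forall x y, 0 <= v y x,
        forall x, \sum_(y <- s) v y x = 1 &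
        forall x y, v y x != 0 -> `|f x - f y| < d].
Proof.
move=> cX cf d0.
have [s hs] : exists s : seq X, forall x, exists2 y, y \in s & `|f x - f y| < d.
  have : compact (range f) by apply: continuous_compact => //; exact: continuous_subspaceT.
  rewrite compact_cover => /(_ X setT (fun y => ball (f y) d)) [y _||D _ hD].
  - exact: ball_open.
  - by move=> _ [x _ <-]; exists x => //; exact: ballxx.
  exists (finmap.enum_fset D) => x; have [|y yD] := hD (f x); first by exists x.
  by rewrite -ball_normE /ball_ /= distrC => xy; exists y.
pose u y x : R[i] := d - `|f x - f y| + `|d - `|f x - f y| |.
have dE x y : d - `|f x - f y| \is Num.real.
  by rewrite rpredB ?normr_real// gtr0_real.
have u_ge0 x y : 0 <= u y x.
  rewrite /u; have [t0|t0] := real_ge0P (dE x y); first by rewrite addr_ge0.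
  by rewrite subrr.
have u_gt0 x y : `|f x - f y| < d -> 0 < u y x.
  by rewrite -subr_gt0 => t0; rewrite /u ltr_pwDl.
have u_neq0 x y : u y x != 0 -> `|f x - f y| < d.
  rewrite /u -(subr_gt0 _ d); have [//|t0] := real_ltP (real0 _) (dE x y).
  by rewrite ler0_norm// subrr eqxx.
have U_gt0 x : 0 < \sum_(y <- s) u y x.
  have [y ys xy] := hs x; rewrite (big_rem y)//= ltr_pwDl ?u_gt0//.
  exact: sumr_ge0.
have u_cont y : continuous (u y).
  move=> x; have dc : d - `|f z - f y| @[z --> x] --> d - `|f x - f y|.
    apply: cvgB; first exact: cvg_cst.
    by apply: cvg_norm; apply: cvgB; [exact: cf|exact: cvg_cst].
  exact: (cvgD dc (cvg_norm dc)).
exists s, (fun y x => u y x / \sum_(z <- s) u z x); split.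
- move=> y x; apply: cvgM; first exact: u_cont.
  by apply: cvgV; [rewrite gt_eqF|exact: sum_continuous].
- by move=> x y; rewrite divr_ge0// ltW.
- by move=> x; rewrite -mulr_suml divff// gt_eqF.
- by move=> x y; rewrite mulf_eq0 negb_or => /andP[/u_neq0].
Qed.

Lemma dual_elt_sum (R : realType) (X : topologicalType)
    (phi : (X -> R[i]) -> R[i]) (I : Type) (s : seq I) (c : I -> R[i])
    (v : I -> X -> R[i]) :
  dual_elt phi -> (forall i, continuous (v i)) ->
  phi (fun x => \sum_(i <- s) c i * v i x) = \sum_(i <- s) c i * phi (v i).
Proof.
move=> [lin_phi [M [M0 phi_le]]] cv; elim: s => [|i s ih].
  rewrite big_nil; under eq_fun do rewrite big_nil.
  (* That [phi] vanishes at the zero function follows from its norm bound with [b = 0]. *)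
  apply/eqP; rewrite -normr_le0 -[leRHS](mulr0 M); apply: phi_le => //.
    by move=> x; exact: cvg_cst.
  by move=> t; rewrite normr0.
rewrite big_cons -ih -lin_phi//; last first.
  apply: sum_continuous => j x; apply: cvgM; [exact: cvg_cst|exact: cv].
by congr phi; apply/funext => x; rewrite big_cons.
Qed.

(** A partition of unity [v] puts [h] uniformly close to the sum of the [h y * v y], and [phi] sends
    that sum to a combination of evaluations whose coefficients [phi (v y)] do not depend on [h]. *)
Lemma dual_elt_approx (R : realType) (X : topologicalType)
    (V : normedModType R[i]) (f : X -> V) (phi : (X -> R[i]) -> R[i])
    (e : R[i]) :
  compact [set: X] -> continuous f -> dual_elt phi -> 0 < e ->
  exists p : pexpr R[i] X, forall h : X -> R[i],
    (forall x y, `|h x - h y| <= `|f x - f y|) -> `|phi h - pval h p| <= e.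
Proof.
move=> cX cf phiE e0; have [lin_phi [M [M0 phi_le]]] := phiE.
pose d := e / (1 + M); have d0 : 0 < d by rewrite divr_gt0// ltr_pwDl.
have [s [v [cv v_ge0 v1 v_near]]] := partition_of_unity cX cf d0.
exists (foldr (fun y p => PAdd (PMul (PGen y) (PConst (phi (v y)))) p)
          (PConst 0) s) => h hf.
have -> : pval h (foldr (fun y p => PAdd (PMul (PGen y) (PConst (phi (v y)))) p)
    (PConst 0) s) = \sum_(y <- s) h y * phi (v y).
  by elim: (s) => [|y t ih]; rewrite ?big_nil// big_cons /= ih.
have ch := continuous_of_dist_le cf hf.
have cT : continuous (fun x => \sum_(y <- s) h y * v y x).
  apply: sum_continuous => y x; apply: cvgM; [exact: cvg_cst|exact: cv].
rewrite -dual_elt_sum// addrC -mulN1r -lin_phi//.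
apply: (@le_trans _ _ (M * d)); last first.
  by rewrite /d mulrA ler_pdivrMr ?ltr_pwDl// mulrC ler_wpM2l ?(ltW e0)// lerDr.
apply: phi_le => [x||x]; [|exact: ltW|].
  apply: cvgD; last exact: ch.
  by apply: cvgM; [exact: cvg_cst|exact: cT].
(* As the [v y x] sum to 1, the error is an average of the [h x - h y], in which only [y] with
   [|f x - f y| < d] have weight. *)
rewrite mulN1r -[h x]mulr1 -(v1 x) mulr_sumr addrC -sumrB.
rewrite (le_trans (ler_norm_sum _ _ _))// -[leRHS]mulr1 -(v1 x) mulr_sumr.
apply: ler_sum => y _; rewrite -mulrBl normrM (ger0_norm (v_ge0 _ _)).
have [->|/v_near/ltW xy] := eqVneq (v y x) 0; first by rewrite !mulr0.
by rewrite ler_wpM2r// (le_trans (hf x y)).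
Qed.

Lemma ft_poly_uapprox (R : realType) (X : topologicalType)
    (V : normedModType R[i]) (f : X -> V) (S : Type) (h : bounded_family R S X)
    (P : (X -> R[i]) -> R[i]) :
  compact [set: X] -> continuous f ->
  (forall s x y, `|h s x - h s y| <= `|f x - f y|) -> ft_poly P ->
  uapprox h (fun s => P (h s)).
Proof.
move=> cX cf hf [n [c [d [phi [phiE PE]]]]].
have ch s : continuous (h s) by exact: continuous_of_dist_le cf (hf s).
under eq_fun do rewrite PE//.
(* The induction stops at [d i] because [phi i j] is known to be a functional only for [j < d i]. *)
have uprod (i : 'I_n) m : (m <= d i)%N ->
    uapprox h (fun s => \prod_(j < m) phi i j (h s)).
  elim: m => [_|m ih mi].
    under eq_fun do rewrite big_ord0; exact: (uapprox_pval _ (PConst 1)).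
  under eq_fun do rewrite big_ord_recr /=.
  apply: uapproxM; first exact/ih/ltnW.
  move=> e e0; have [p hp] := dual_elt_approx cX cf (phiE i m mi) e0.
  by exists p => s; exact: hp.
have usum (r : seq 'I_n) : uapprox h
    (fun s => \sum_(i <- r) c i * \prod_(j < d i) phi i j (h s)).
  elim: r => [|i r ih].
    under eq_fun do rewrite big_nil; exact: (uapprox_pval _ (PConst 0)).
  under eq_fun do rewrite big_cons.
  by apply: uapproxD => //; apply: uapproxM;
    [exact: (uapprox_pval _ (PConst (c i)))|exact: uprod].
exact: usum.
Qed.

Set Implicit Arguments. Unset Strict Implicit. Unset Printing Implicit Defensive.

(** * The Banach algebra of a bounded family and its spectrum *)

Section PolynomialAlgebra.
Variables (R : realType) (S X : Type) (h : bounded_family R S X).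

Fact polyalg_one_subproof : (fun=> 1) \in uapprox_pred h.
Proof. exact/asboolP/(uapprox_pval _ (PConst 1)). Qed.
Definition polyalg_one : polyalg h := PolyAlg polyalg_one_subproof.

Fact polyalg_mul_subproof (a b : polyalg h) :
  (fun s => a s * b s) \in uapprox_pred h.
Proof. by apply/asboolP/uapproxM; exact: polyalgP. Qed.
Definition polyalg_mul (a b : polyalg h) : polyalg h :=
  PolyAlg (polyalg_mul_subproof a b).

Fact polyalg_gen_subproof (x : X) : (fun s => h s x) \in uapprox_pred h.
Proof. exact/asboolP/(uapprox_pval _ (PGen x)). Qed.
Definition polyalg_gen (x : X) : polyalg h := PolyAlg (polyalg_gen_subproof x).

Lemma polyalg_comm_banach : comm_banach_algebra polyalg_mul polyalg_one.
Proof.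
split; first split.
- by move=> a b c; apply: polyalg_ext => s /=; rewrite mulrA.
- by move=> a b; apply: polyalg_ext => s /=; rewrite mulrC.
- by move=> a; apply: polyalg_ext => s /=; rewrite mul1r.
- by move=> a b c; apply: polyalg_ext => s /=; rewrite mulrDl.
- by move=> k a b; apply: polyalg_ext => s /=; rewrite -mulrA.
move=> a b; apply: polyalg_norm_le => [|s]; first by rewrite mulr_ge0.
by rewrite normrM ler_pM//; exact: polyalg_norm_ge.
Qed.

Lemma aval_polyalg (p : pexpr R[i] X) (s : S) :
  aval polyalg_mul polyalg_one polyalg_gen p s = pval (h s) p.
Proof.
elim: p => [c|x|p ihp q ihq|p ihp q ihq] //=; first exact: mulr1.
  by rewrite -ihp -ihq.
by rewrite ihp ihq.
Qed.

Lemma polyalg_generates : generates polyalg_mul polyalg_one (range polyalg_gen).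
Proof.
move=> T clT T1 TD TM TZ Tgen; apply/seteqP; split=> // a _; apply: clT => B.
rewrite -nbhs_ballE => -[e /= e0 aeB].
have [p hp] := polyalgP a (divr_gt0 e0 (ltr0n _ 2)).
exists (aval polyalg_mul polyalg_one polyalg_gen p); split.
  elim: p {hp} => [c|x|p ihp q ihq|p ihp q ihq] /=.
  - exact: TZ.
  - by apply: Tgen; exists x.
  - exact: TD.
  - exact: TM.
apply: aeB; rewrite -ball_normE /ball_ /=.
apply: (@le_lt_trans _ _ (e / 2)); last by rewrite ltr_pdivrMr// ltr_pMr// ltr1n.
apply: polyalg_norm_le => [|s]; first by rewrite divr_ge0// ltW.
by have := hp s; rewrite -aval_polyalg.
Qed.

(** Evaluation at [s] is multiplicative and kills every generator of the ideal, but not [one]. *)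
Lemma polyalg_joint_spectrum (s : S) :
  joint_spectrum polyalg_mul polyalg_one polyalg_gen (h s).
Proof.
move=> [t] /(congr1 (fun a : polyalg h => a s)).
have -> : (\sum_(p <- t) polyalg_mul p.1
    (h s p.2 *: polyalg_one - polyalg_gen p.2)) s = 0.
  elim: t => [|p t ih]; first by rewrite big_nil.
  rewrite big_cons [LHS]/= -[X in _ + X = _]/((\sum_(p <- t) polyalg_mul p.1
    (h s p.2 *: polyalg_one - polyalg_gen p.2)) s) ih addr0.
  by rewrite [X in _ * (X - _)](mulr1 (h s p.2)) subrr mulr0.
by move=> /eqP; rewrite oner_eq0.
Qed.

(** Over an empty [S] the algebra is zero, so [one] is the empty combination. *)
Lemma polyalg_joint_spectrum_inhabited (lam : X -> R[i]) :
  joint_spectrum polyalg_mul polyalg_one polyalg_gen lam -> inhabited S.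
Proof.
move=> spl; apply: contrapT => noS; apply: spl; exists [::].
by rewrite big_nil; apply: polyalg_ext => s; case: noS.
Qed.

End PolynomialAlgebra.

(** * Realizing a polynomially convex compact set as a joint spectrum *)

Section CompactPolynomialAlgebra.
Variables (R : realType) (X : topologicalType) (K : set (X -> R[i])).
Hypothesis X_compact : compact [set: X].
Hypothesis K_continuous : forall k, K k -> continuous k.
Hypothesis K_compact : @compact {uniform X -> R[i]} K.

Fact inclusion_family_bounded (x : X) :
  exists M : R[i], forall s : {k : X -> R[i] | K k}, `|sval s x| <= M.
Proof.
have [M hM] := compact_bounded_at K_compact x.
by exists M => s; exact: hM (svalP s).
Qed.
Definition inclusion_family : bounded_family R {k : X -> R[i] | K k} X :=
  BoundedFamily inclusion_family_bounded.

Local Notation gen := (polyalg_gen inclusion_family).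
Local Notation sp := (joint_spectrum (@polyalg_mul _ _ _ inclusion_family)
  (polyalg_one inclusion_family) gen).

(** The norm of [gen x - gen y] is the supremum of [|k x - k y|] over [K], so this is equicontinuity
    of [K]. *)
Lemma polyalg_gen_continuous : continuous gen.
Proof.
move=> x; apply/cvgrPdist_le => e e0.
apply: filterS (compact_equicontinuous_at K_continuous K_compact x e0) => y xy.
apply: polyalg_norm_le => [|s]; [exact: ltW|exact: xy _ (svalP s)].
Qed.

Lemma polyalg_joint_spectrumE : poly_convex K -> K = sp.
Proof.
move=> KE; have hA := polyalg_comm_banach inclusion_family.
have cgen := polyalg_gen_continuous.
apply/seteqP; split=> [k Kk|lam spl].
  by have /= := @polyalg_joint_spectrum _ _ _ inclusion_family (exist _ k Kk).
rewrite KE; split; first exact: joint_spectrum_continuous spl.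
move=> P ftP M PM; apply/ler_addgt0Pr => e e0.
have e2 : 0 < e / 2 by rewrite divr_gt0.
(* [L] contains both [K] and [lam] and is controlled by [gen], so a single [p] approximates [P] on
   [K] and at [lam] simultaneously. *)
pose L (l : X -> R[i]) := (forall x, `|l x| <= `|gen x|) /\
  (forall x y, `|l x - l y| <= `|gen x - gen y|).
have LK k : K k -> L k.
  move=> Kk; pose s : {k : X -> R[i] | K k} := exist _ k Kk.
  by split=> [x|x y]; [exact: (polyalg_norm_ge (gen x) s)
                      |exact: (polyalg_norm_ge (gen x - gen y) s)].
have Llam : L lam.
  split=> [x|x y]; last exact: joint_spectrum_dist_le spl.
  exact: (joint_spectrum_pval_le hA (PGen x) spl).
have Lb x : exists M : R[i], forall s : {l | L l}, `|sval s x| <= M.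
  by exists `|gen x| => s; exact: (svalP s).1.
have [|p hp] := @ft_poly_uapprox R X _ gen _ (BoundedFamily Lb) P X_compact cgen
  _ ftP _ e2.
  by move=> s x y; exact: (svalP s).2.
have PMe : `|aval (@polyalg_mul _ _ _ inclusion_family)
    (polyalg_one inclusion_family) gen p| <= M + e / 2.
  (* For empty K the bound M could be negative, but then A = 0 and sp is empty. *)
  have [[k0 Kk0]] := polyalg_joint_spectrum_inhabited spl.
  have M0 : 0 <= M by exact: le_trans (PM _ Kk0).
  apply: polyalg_norm_le => [|[k Kk]]; first by rewrite addr_ge0// ltW.
  rewrite aval_polyalg /=.
  have /= := hp (exist _ k (LK k Kk)).
  rewrite distrC => kp.
  by rewrite -(subrK (P k) (pval k p)) addrC (le_trans (ler_normD _ _))// lerD// PM.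
(* [P lam] is within [e / 2] of [p(lam)], whose modulus is at most the norm of [p(gen)], hence at
   most [M + e / 2]. *)
have /= lamp := hp (exist _ lam Llam).
rewrite -(subrK (pval lam p) (P lam)) (le_trans (ler_normD _ _))//.
rewrite (splitr e) addrA addrC lerD//.
exact: le_trans (joint_spectrum_pval_le hA p spl) PMe.
Qed.

End CompactPolynomialAlgebra.

(* X compact Hausdorff; K a compact subset of C(X) (uniform-norm topology,
   i.e. the topology of uniform convergence on X), K consisting of continuous
   functions. *)
Theorem theorem3p3 (R : realType) (X : topologicalType) (K : set (X -> R[i])) :
  compact [set: X] -> hausdorff_space X ->
  (forall k, K k -> continuous k) ->
  @compact {uniform X -> R[i]} K ->
  (poly_convex K <->
   exists (A : completeNormedModType R[i]) (mul : A -> A -> A) (one : A)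
          (f : X -> A),
     [/\ comm_banach_algebra mul one, continuous f,
         generates mul one (range f) & K = joint_spectrum mul one f]).
Proof.
move=> cX _ cK kK; split=> [KE|[A [mul [one [f [hA cf gen ->]]]]]].
  pose h := inclusion_family kK.
  exists (polyalg h), (@polyalg_mul _ _ _ h), (polyalg_one h), (polyalg_gen h).
  split; [exact: polyalg_comm_banach|exact: polyalg_gen_continuous
         |exact: polyalg_generates|exact: polyalg_joint_spectrumE].
exact: joint_spectrum_poly_convex.
Qed.
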